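(* Let $\Delta\subseteq 2^{[n]}$ be a down-set, let $\mathcal{F}$ be the family of maximal elements of $\Delta$ and let $\mathcal{M}$ be the family of blockers of $\Delta$. Then, as polynomials in $x,y$, $$H_\Delta(x,y)=\sum_{\emptyset\neq S\subseteq\mathcal{F}}(-1)^{|S|+1}(x+y)^{|\bigcap S|}\,y^{\,n-|\bigcap S|}$$ and $$H_\Delta(x,y)=\sum_{T\subseteq\mathcal{M}}(-1)^{|T|}(x+y)^{n-|\bigcup T|}\,x^{|\bigcup T|}.$$
   Context: $[n]=\{1,\ldots,n\}$ and $2^{[n]}$ is the family of all subsets of $[n]$. A family $\Delta\subseteq 2^{[n]}$ is a down-set if $\sigma\in\Delta$ and $\tau\subseteq\sigma$ imply $\tau\in\Delta$. The maximal elements of $\Delta$ are the inclusion-maximal sets in $\Delta$. The blockers of $\Delta$ are the inclusion-minimal elements of $2^{[n]}\setminus\Delta$. For any family $\Delta\subseteq 2^{[n]}$, the two-variable generating function is $$H_\Delta(x,y)=\sum_{\sigma\in\Delta}x^{|\sigma|}y^{n-|\sigma|}.$$ For a subfamily $S$ of $\mathcal{F}$ (respectively $T$ of $\mathcal{M}$), $|S|$ (respectively $|T|$) is the number of sets in the subfamily, $\bigcap S$ is the intersection of all the sets in $S$, and $\bigcup T$ is the union of all the sets in $T$ (with $\bigcup\emptyset=\emptyset$). The first sum runs over all nonempty subfamilies of $\mathcal{F}$, the second over all subfamilies of $\mathcal{M}$, including the empty one. *)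

(* Defs.v *)
From HB Require Import structures.
From mathcomp Require Import all_boot all_order all_algebra.
From mathcomp.multinomials Require Import mpoly.

Set Implicit Arguments.
Unset Strict Implicit.
Unset Printing Implicit Defensive.

Import GRing.Theory.
Local Open Scope ring_scope.

(* The ground set [n] = {1, ..., n} is represented by 'I_n = {0, ..., n-1}. *)

Definition down_set (n : nat) (Delta : {set {set 'I_n}}) : Prop :=
  forall s t : {set 'I_n}, s \in Delta -> t \subset s -> t \in Delta.

Definition maximal_elements (n : nat) (Delta : {set {set 'I_n}}) :
    {set {set 'I_n}} :=
  [set s : {set 'I_n} | maxset (fun t => t \in Delta) s].

Definition blockers (n : nat) (Delta : {set {set 'I_n}}) : {set {set 'I_n}} :=
  [set s : {set 'I_n} | minset (fun t => t \notin Delta) s].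

Definition varx : {mpoly int[2]} := 'X_(ord0 : 'I_2).
Definition vary : {mpoly int[2]} := 'X_(ord_max : 'I_2).

Definition genfun (n : nat) (Delta : {set {set 'I_n}}) : {mpoly int[2]} :=
  \sum_(s in Delta) varx ^+ #|s| * vary ^+ (n - #|s|).

(* Main.v *)
Require Import Defs.
From HB Require Import structures.
From mathcomp Require Import all_boot all_order all_algebra.
From mathcomp.multinomials Require Import mpoly.

Set Implicit Arguments.
Unset Strict Implicit.
Unset Printing Implicit Defensive.

Import GRing.Theory.
Local Open Scope ring_scope.

(** Give each subset [s] of the ground set the weight [x^|s| y^(n-|s|)].
    Expanding a product of binomials shows that the total weight of the subsets
    of [A] is [(x+y)^|A| y^(n-|A|)], and that the total weight of the supersets
    of [U] is [(x+y)^(n-|U|) x^|U|]: these are the terms on the right-hand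
    sides, up to sign. A down-set is the union of the principal down-sets below
    its maximal elements, and its complement is the union of the principal
    up-sets above its blockers, so both formulas are inclusion-exclusion.

    Concretely, after exchanging the order of summation, the coefficient of the
    weight of [s] is a signed count of the subfamilies of [F_s], the family of
    maximal elements containing [s] (respectively of [M_s], the family of
    blockers contained in [s]). Such a signed count vanishes unless the family
    is empty ([sum_sign_subset]), and [s] belongs to the down-set exactly when
    [F_s] is nonempty ([down_set_maximalP]), respectively when [M_s] is empty
    ([down_set_blockersP]). *)

(** The product over all [i] of [F i + G i], where [F i] is [x] on [A] and [0]
    elsewhere while [G i] is [0] on [U] and [y] elsewhere: a choice of one
    summand per factor is a set [s], and its term survives exactly when
    [U \subset s \subset A]. *)
Lemma sum_weight_interval (R : comNzRingType) (I : finType) (x y : R)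
    (U A : {set I}) : U \subset A ->
  \sum_(s : {set I} | (U \subset s) && (s \subset A))
     x ^+ #|s| * y ^+ (#|I| - #|s|)
  = x ^+ #|U| * (x + y) ^+ (#|A| - #|U|) * y ^+ (#|I| - #|A|).
Proof.
move=> sUA.
pose F i := if i \in A then x else 0.
pose G i := if i \in U then 0 else y.
have cardDE (B : {set I}) : (#|I| - #|B|)%N = #|~: B|.
  by rewrite -(cardsC B) addKn.
transitivity (\prod_i (F i + G i)).
  rewrite bigA_distr [LHS]big_mkcond; apply: eq_bigr => s _ /=.
  rewrite cardDE.
  case: ifP => [/andP[sUs ssA]|].
    rewrite (bigID (mem s)) /= -!prodr_const; congr (_ * _).
      by apply: eq_bigr => i si; rewrite si /F (subsetP ssA).
    apply: eq_big => [i|i]; rewrite in_setC // => si.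
    by rewrite (negPf si) /G ifN //; apply: contraNN si; exact: subsetP.
  move/negbT; rewrite negb_and => /orP[] /subsetPn[i iB iC].
    by rewrite (bigD1 i) //= (negPf iC) /G iB mul0r.
  by rewrite (bigD1 i) //= iB /F (negPf iC) mul0r.
rewrite (bigID (mem A)) /= (bigID (mem U)) /=; congr (_ * _ * _).
- rewrite -prodr_const; apply: eq_big => [i|i /andP[Ai Ui]].
    by case: (boolP (i \in U)) => [/(subsetP sUA)->|]; rewrite ?andbF.
  by rewrite /F /G Ai Ui addr0.
- have -> : (#|A| - #|U|)%N = #|A :\: U|.
    by rewrite cardsD (setIidPr sUA).
  rewrite -prodr_const; apply: eq_big => [i|i /andP[Ai Ui]].
    by rewrite inE andbC.
  by rewrite /F /G Ai (negPf Ui).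
rewrite cardDE -prodr_const; apply: eq_big => [i|i Ai]; first by rewrite inE.
by rewrite /F /G (negPf Ai) add0r ifN //; apply: contraNN Ai; exact: subsetP.
Qed.

Lemma sum_weight_subset (R : comNzRingType) (I : finType) (x y : R)
    (A : {set I}) :
  \sum_(s : {set I} | s \subset A) x ^+ #|s| * y ^+ (#|I| - #|s|)
  = (x + y) ^+ #|A| * y ^+ (#|I| - #|A|).
Proof.
have := sum_weight_interval x y (sub0set A).
rewrite cards0 subn0 mul1r => <-.
by apply: eq_bigl => s; rewrite sub0set.
Qed.

Lemma sum_weight_superset (R : comNzRingType) (I : finType) (x y : R)
    (U : {set I}) :
  \sum_(s : {set I} | U \subset s) x ^+ #|s| * y ^+ (#|I| - #|s|)
  = (x + y) ^+ (#|I| - #|U|) * x ^+ #|U|.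
Proof.
have := sum_weight_interval x y (subsetT U).
rewrite cardsT subnn mulr1 mulrC => <-.
by apply: eq_bigl => s; rewrite subsetT andbT.
Qed.

(** This is the weight sum at [x = -1], [y = 1], whose value is [0 ^+ #|A|]. *)
Lemma sum_sign_subset (R : comNzRingType) (I : finType) (A : {set I}) :
  \sum_(S : {set I} | S \subset A) (-1) ^+ #|S| = (A == set0)%:R :> R.
Proof.
have := sum_weight_subset (-1 : R) 1 A.
rewrite addNr expr1n mulr1 expr0n cards_eq0 => <-.
by apply: eq_bigr => S _; rewrite expr1n mulr1.
Qed.

Lemma sum_sign_nonempty_subset (R : comNzRingType) (I : finType)
    (A : {set I}) :
  \sum_(S : {set I} | (S != set0) && (S \subset A)) (-1) ^+ (#|S| + 1)
  = (A != set0)%:R :> R.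
Proof.
have := sum_sign_subset R A.
rewrite (bigD1 set0) ?sub0set //= cards0 expr0 => sumE.
rewrite (eq_bigl _ _ (fun S => andbC _ _)).
under eq_bigr do rewrite addn1 exprS mulN1r.
rewrite sumrN; move/(canRL (addKr 1)): sumE => ->.
by rewrite opprD opprK; case: eqP => _; rewrite /= ?subrr ?subr0.
Qed.

(** By finiteness every member of the family lies below a maximal one. *)
Lemma down_set_maximalP n (Delta : {set {set 'I_n}}) (s : {set 'I_n}) :
  down_set Delta ->
  (s \in Delta) = ([set f in maximal_elements Delta | s \subset f] != set0).
Proof.
move=> dD; apply/idP/set0Pn => [sD|[f]].
  have [f maxf sf] := @maxset_exists _ (fun t => t \in Delta) s sD.
  by exists f; rewrite !inE maxf.
by rewrite !inE => /andP[/maxsetp fD sf]; exact: dD fD sf.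
Qed.

(** By finiteness every non-member of the family lies above a minimal one. *)
Lemma down_set_blockersP n (Delta : {set {set 'I_n}}) (s : {set 'I_n}) :
  down_set Delta ->
  (s \in Delta) = ([set m in blockers Delta | m \subset s] == set0).
Proof.
move=> dD; apply/idP/eqP => [sD|M0].
  apply/setP => m; rewrite !inE; apply/andP => -[/minsetp mD ms].
  by rewrite (dD _ _ sD ms) in mD.
apply: contraTT isT => sD.
have [m minm ms] := @minset_exists _ (fun t => t \notin Delta) s sD.
by have := in_set0 m; rewrite -M0 !inE minm ms.
Qed.

(** Inclusion-exclusion as a double count: [W j] collects the weights of the
    [i] related to [j], and the signs [c j] attached to a fixed [i] add up to
    the indicator of [D] at [i]. *)
Lemma sum_indicator_exchange (R : comNzRingType) (I J : finType)
    (D : pred I) (Q : pred J) (r : J -> I -> bool) (w : I -> R)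
    (c W : J -> R) :
  (forall j, \sum_(i | r j i) w i = W j) ->
  (forall i, \sum_(j | Q j && r j i) c j = (D i)%:R) ->
  \sum_(i | D i) w i = \sum_(j | Q j) c j * W j.
Proof.
move=> sumW sumD.
under [RHS]eq_bigr => j _ do rewrite -sumW big_distrr /=.
rewrite (exchange_big_dep predT) //= big_mkcond /=.
apply: eq_bigr => i _; rewrite -big_distrl /= sumD.
by case: (D i); rewrite ?mul1r ?mul0r.
Qed.

Theorem theorem1 (n : nat) (Delta : {set {set 'I_n}})
    (hDelta : down_set Delta) :
  genfun Delta =
    \sum_(S : {set {set 'I_n}} | (S != set0) && (S \subset maximal_elements Delta))
      (-1) ^+ (#|S| + 1)
      * (varx + vary) ^+ #|\bigcap_(s in S) s|
      * vary ^+ (n - #|\bigcap_(s in S) s|)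
  /\
  genfun Delta =
    \sum_(T : {set {set 'I_n}} | T \subset blockers Delta)
      (-1) ^+ #|T|
      * (varx + vary) ^+ (n - #|\bigcup_(t in T) t|)
      * varx ^+ #|\bigcup_(t in T) t|.
Proof.
have subset_sep (F S : {set {set 'I_n}}) (p : pred {set 'I_n}) :
    (S \subset [set f in F | p f]) = (S \subset F) && [forall f in S, p f].
  rewrite setIdE subsetI; congr (_ && _).
  by apply/subsetP/forall_inP => Sp f /Sp; rewrite inE.
rewrite /genfun; split; under [RHS]eq_bigr do rewrite -mulrA.
- apply: (sum_indicator_exchange
            (D := fun s => s \in Delta)
            (Q := fun S => (S != set0) && (S \subset maximal_elements Delta))
            (c := fun S => (-1) ^+ (#|S| + 1))
            (r := fun S s => s \subset \bigcap_(f in S) f)) => [S|s].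
    by have := sum_weight_subset varx vary (\bigcap_(f in S) f); rewrite card_ord.
  rewrite (down_set_maximalP s hDelta) -sum_sign_nonempty_subset.
  apply: eq_bigl => S; rewrite subset_sep andbA; congr (_ && _).
  by apply/bigcapsP/forall_inP.
- apply: (sum_indicator_exchange
            (D := fun s => s \in Delta)
            (Q := fun T : {set {set 'I_n}} => T \subset blockers Delta)
            (c := fun T => (-1) ^+ #|T|)
            (r := fun T s => \bigcup_(t in T) t \subset s)) => [T|s].
    by have := sum_weight_superset varx vary (\bigcup_(t in T) t); rewrite card_ord.
  rewrite (down_set_blockersP s hDelta) -sum_sign_subset.
  apply: eq_bigl => T; rewrite subset_sep; congr (_ && _).
  by apply/bigcupsP/forall_inP.
Qed.
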